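(* Let $P(z)\in\mathbb{C}[[z]]$ be Hessian nilpotent. The following statements are equivalent. (1) For every $k\ge 1$, $\Delta^mP^{m+k}=0$ for all sufficiently large $m$. (2) There exists $k_0\ge 1$ such that $\Delta^mP^{m+k_0}=0$ for all sufficiently large $m$. (3) $\Delta^mP^{m+1}=0$ for all sufficiently large $m$.
   Context: $z=(z_1,\dots,z_n)$ and $\Delta=\sum_{i=1}^n \partial^2/\partial z_i^2$. $P$ is Hessian nilpotent if its Hessian matrix $\left(\frac{\partial^2 P}{\partial z_i\partial z_j}\right)$ is nilpotent. *)

(* Defs.v *)
From HB Require Import structures.
From mathcomp Require Import all_boot all_order all_algebra.
From mathcomp Require Import boolp reals complex.
From mathcomp Require Import mpoly.

Set Implicit Arguments.
Unset Strict Implicit.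
Unset Printing Implicit Defensive.

Import GRing.Theory.
Local Open Scope ring_scope.

(* Formal power series in n variables: arbitrary families of coefficients
   indexed by the exponents 'X_{1..n}.  They are wrapped in a record so that
   the pointwise ring structure on functions cannot be inferred for them. *)
Record fps (R : Type) (n : nat) := FPS { fpscoef : 'X_{1..n} -> R }.

Notation "{ 'fps' R [ n ] }" := (fps R n)
  (at level 0, R at level 2, n at level 2, format "{ 'fps'  R [ n ] }").

HB.instance Definition _ (R : Type) n := [isNew for @fpscoef R n].
HB.instance Definition _ (R : eqType) n := [Equality of {fps R[n]} by <:].
HB.instance Definition _ (R : choiceType) n := [Choice of {fps R[n]} by <:].

Lemma fpsP (R : Type) n (p q : {fps R[n]}) :
  (forall m, fpscoef p m = fpscoef q m) <-> p = q.
Proof.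
split=> [|-> //]; case: p q => [f] [g] /= fg.
by congr FPS; apply/funext.
Qed.

Section FpsZmodule.
Variables (R : zmodType) (n : nat).
Implicit Types p q : {fps R[n]}.

Definition fps_zero : {fps R[n]} := FPS (fun=> 0).
Definition fps_opp p : {fps R[n]} := FPS (fun m => - fpscoef p m).
Definition fps_add p q : {fps R[n]} := FPS (fun m => fpscoef p m + fpscoef q m).

Fact fps_addA : associative fps_add.
Proof. by move=> p q r; apply/fpsP => m; apply: addrA. Qed.
Fact fps_addC : commutative fps_add.
Proof. by move=> p q; apply/fpsP => m; apply: addrC. Qed.
Fact fps_add0 : left_id fps_zero fps_add.
Proof. by move=> p; apply/fpsP => m; apply: add0r. Qed.
Fact fps_addN : left_inverse fps_zero fps_opp fps_add.
Proof. by move=> p; apply/fpsP => m; apply: addNr. Qed.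

HB.instance Definition _ := GRing.isZmodule.Build {fps R[n]}
  fps_addA fps_addC fps_add0 fps_addN.

Lemma fpscoef0 m : fpscoef (0 : {fps R[n]}) m = 0.
Proof. by []. Qed.
Lemma fpscoefD p q m : fpscoef (p + q) m = fpscoef p m + fpscoef q m.
Proof. by []. Qed.
Lemma fpscoefN p m : fpscoef (- p) m = - fpscoef p m.
Proof. by []. Qed.
Lemma fpscoef_sum (I : Type) (r : seq I) (S : pred I) (F : I -> {fps R[n]}) m :
  fpscoef (\sum_(i <- r | S i) F i) m = \sum_(i <- r | S i) fpscoef (F i) m.
Proof. by elim/big_rec2: _ => // i x y _ <-. Qed.

End FpsZmodule.

Section FpsRing.
Variables (R : comNzRingType) (n : nat).
Implicit Types p q : {fps R[n]}.

Definition fps_one : {fps R[n]} := FPS (fun m => (m == 0%MM)%:R).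

(* The bound on the degrees of k.1 and k.2 only serves to make the index set
   finite, it follows from m = k.1 + k.2; compare mcoeffM in mpoly. *)
Definition fps_mul p q : {fps R[n]} := FPS (fun m =>
  \sum_(k : 'X_{1..n < (mdeg m).+1, (mdeg m).+1} | m == (k.1 + k.2)%MM)
     fpscoef p k.1 * fpscoef q k.2).

Definition fps_trunc d p : {mpoly R[n]} :=
  \sum_(m : 'X_{1..n < d}) fpscoef p m *: 'X_[m].

Lemma fps_truncE d p m : (mdeg m < d)%N -> (fps_trunc d p)@_m = fpscoef p m.
Proof. exact: mcoeff_mpoly. Qed.

Lemma fps_mul_mpoly p q (p' q' : {mpoly R[n]}) m :
    (forall k, (mdeg k <= mdeg m)%N -> p'@_k = fpscoef p k) ->
    (forall k, (mdeg k <= mdeg m)%N -> q'@_k = fpscoef q k) ->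
  fpscoef (fps_mul p q) m = (p' * q')@_m.
Proof.
move=> pE qE; rewrite mcoeffM /=; apply: eq_bigr => k _.
by rewrite pE ?qE // -ltnS bmdeg.
Qed.

Fact fps_mulA : associative fps_mul.
Proof.
move=> p q r; apply/fpsP => m; set d := (mdeg m).+1.
have tE s k : (mdeg k <= mdeg m)%N -> (fps_trunc d s)@_k = fpscoef s k.
  by move=> km; rewrite fps_truncE.
have tM s t k : (mdeg k <= mdeg m)%N ->
    (fps_trunc d s * fps_trunc d t)@_k = fpscoef (fps_mul s t) k.
  move=> km; symmetry; apply: fps_mul_mpoly => l lk; apply: tE;
  exact: leq_trans lk km.
rewrite (fps_mul_mpoly (tE p) (tM q r)) mulrA.
by rewrite -(fps_mul_mpoly (tM p q) (tE r)).
Qed.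

Fact fps_mulC : commutative fps_mul.
Proof.
move=> p q; apply/fpsP => m.
have tE s k : (mdeg k <= mdeg m)%N ->
    (fps_trunc (mdeg m).+1 s)@_k = fpscoef s k.
  by move=> km; rewrite fps_truncE.
by rewrite (fps_mul_mpoly (tE p) (tE q)) mulrC -(fps_mul_mpoly (tE q) (tE p)).
Qed.

Fact fps_mul1 : left_id fps_one fps_mul.
Proof.
move=> p; apply/fpsP => m.
have tE k : (mdeg k <= mdeg m)%N ->
    (fps_trunc (mdeg m).+1 p)@_k = fpscoef p k.
  by move=> km; rewrite fps_truncE.
rewrite (fps_mul_mpoly (p' := 1) _ tE) ?mul1r ?tE // => k _.
by rewrite mcoeff1.
Qed.

Fact fps_mulDl : left_distributive fps_mul +%R.
Proof.
move=> p q r; apply/fpsP => m; rewrite fpscoefD -big_split /=.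
by apply: eq_bigr => k _; rewrite mulrDl.
Qed.

Fact fps_one_neq0 : fps_one != 0.
Proof.
apply/eqP => /fpsP/(_ 0%MM) /=; rewrite eqxx => /eqP.
by rewrite oner_eq0.
Qed.

HB.instance Definition _ := GRing.Zmodule_isComNzRing.Build {fps R[n]}
  fps_mulA fps_mulC fps_mul1 fps_mulDl fps_one_neq0.

(* d/dz_i sends z^(m + e_i) to (m_i + 1) z^m; compare mcoeff_deriv in mpoly. *)
Definition fps_deriv (i : 'I_n) p : {fps R[n]} :=
  FPS (fun m => fpscoef p (m + U_(i))%MM *+ (m i).+1).

Definition fps_laplacian p : {fps R[n]} :=
  \sum_(i < n) fps_deriv i (fps_deriv i p).

Definition fps_hessian p : 'M[{fps R[n]}]_n :=
  \matrix_(i, j) fps_deriv i (fps_deriv j p).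

Definition hessian_nilpotent p : Prop :=
  exists N : nat, fps_hessian p ^+ N = 0.

End FpsRing.

(* Main.v *)
(* Deform P into the solution Q = sum_m Q_m t^m of the Hamilton-Jacobi equation
   dQ/dt = |grad Q|^2 with Q_0 = P, a power series in t over C[[z]].  The Hessian
   H of Q satisfies H' = 2 H^2 for the derivation ' = d/dt - 2 <grad Q, grad>,
   so (tr H^k)' = 2k tr H^(k+1); since tr H^k vanishes at t = 0 for every k >= 1
   when P is Hessian nilpotent, it vanishes identically, and in particular Q is
   harmonic.  Then (k+1) dQ^k/dt = Laplacian(Q^(k+1)), and iterating this shows
   that Laplacian^m P^(m+k) is a nonzero multiple of the coefficient of t^m in Q^k.
   The theorem thus says that Q is a polynomial in t as soon as some F = Q^k with
   k >= 1 is.  This uses the equation again: |grad F|^2 Q = k F dF/dt, so that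
   either dF/dt = 0 or Q is a quotient g / f of polynomials in t with
   g^k = f^k F, whence f divides g over the fraction field of C[[z]]. *)
Require Import Defs.
From HB Require Import structures.
From mathcomp Require Import all_boot all_order all_algebra.
From mathcomp Require Import boolp reals complex.
From mathcomp Require Import mpoly.
Import GRing.Theory.
Local Open Scope ring_scope.

Set Implicit Arguments.
Unset Strict Implicit.
Unset Printing Implicit Defensive.

(** * Derivations of commutative rings, and traces of nilpotent matrices *)

Definition derivation (A : pzRingType) (d : A -> A) : Prop :=
  {morph d : x y / x + y} /\ forall x y, d (x * y) = d x * y + x * d y.

Section Derivation.
Variables (A : comNzRingType) (d : A -> A).
Hypothesis d_der : derivation d.

Lemma derD : {morph d : x y / x + y}. Proof. exact: d_der.1. Qed.
Lemma derM x y : d (x * y) = d x * y + x * d y. Proof. exact: d_der.2. Qed.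
Lemma der0 : d 0 = 0.
Proof. by apply: (@addrI _ (d 0)); rewrite -derD !addr0. Qed.
Lemma der_sum (I : Type) (r : seq I) (S : pred I) (F : I -> A) :
  d (\sum_(i <- r | S i) F i) = \sum_(i <- r | S i) d (F i).
Proof. exact: (big_morph d derD der0). Qed.
Lemma derMn x k : d (x *+ k) = d x *+ k.
Proof. by elim: k => [|k IHk]; rewrite ?mulr0n ?der0 // !mulrS derD IHk. Qed.
Lemma der1 : d 1 = 0.
Proof.
by apply: (@addrI _ (d 1)); rewrite addr0 -{3}(mulr1 1) derM mulr1 mul1r.
Qed.
Lemma derX x k : d (x ^+ k) = (x ^+ k.-1 * d x) *+ k.
Proof.
elim: k => [|k IHk]; first by rewrite expr0 der1.
rewrite exprS derM IHk /= mulrS mulrC; congr (_ + _).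
case: k {IHk} => [|k] /=; first by rewrite !mulr0n mulr0.
by rewrite mulrnAr mulrA -exprS.
Qed.

Lemma der_mulmx m n p (M : 'M[A]_(m, n)) (N : 'M_(n, p)) :
  map_mx d (M *m N) = map_mx d M *m N + M *m map_mx d N.
Proof.
apply/matrixP => i j; rewrite !mxE der_sum -big_split /=.
by apply: eq_bigr => k _; rewrite derM !mxE.
Qed.

(* The hypothesis on M makes M commute with its derivative. *)
Lemma der_mxX n (M : 'M[A]_n) c k : map_mx d M = (M *m M) *+ c ->
  map_mx d (M ^+ k) = M ^+ k.+1 *+ (c * k).
Proof.
move=> dM; elim: k => [|k IHk].
  rewrite muln0 mulr0n expr0; apply/matrixP => i j; rewrite !mxE.
  by case: eqP => _; rewrite ?mulr1n ?mulr0n ?der1 ?der0.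
have -> : M ^+ k.+1 = M *m M ^+ k by rewrite exprS.
rewrite der_mulmx IHk dM mulnS mulrnDr.
by rewrite !mulmxE mulrnAl mulrnAr -mulrA -!exprS.
Qed.

Lemma der_trace n (M : 'M[A]_n) : d (\tr M) = \tr (map_mx d M).
Proof. by rewrite /mxtrace der_sum; apply: eq_bigr => i _; rewrite mxE. Qed.

End Derivation.

Lemma derivation_sub_lincomb (A : comNzRingType) (n : nat)
    (d0 : A -> A) (a : 'I_n -> A) (d : 'I_n -> A -> A) :
  derivation d0 -> (forall l, derivation (d l)) ->
  derivation (fun x => d0 x - \sum_l a l * d l x).
Proof.
move=> d0_der d_der; split=> x y.
  rewrite (derD d0_der) addrACA -opprD -big_split /=; congr (_ - _).
  by apply: eq_bigr => l _; rewrite (derD (d_der l)) mulrDr.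
rewrite (derM d0_der) mulrBl mulrBr addrACA -opprD; congr (_ - _).
rewrite mulr_suml mulr_sumr -big_split /=; apply: eq_bigr => l _.
by rewrite (derM (d_der l)) mulrDr mulrA [x * _]mulrCA.
Qed.

(** As M^N = 0, the matrix XI - M divides (XI)^N; by determinants [char_poly M] divides a power of
    X. Being monic it is itself a power of X, of degree the matrix size, so its subleading
    coefficient, -tr M, is 0. *)
Lemma trace_nilpotent (A : idomainType) n (M : 'M[A]_n) N :
  M ^+ N = 0 -> \tr M = 0.
Proof.
case: n M => [|n] M MN0; first by rewrite /mxtrace big_ord0.
have dvdM : char_poly M %| ('X - 0%:P) ^+ (N * n.+1).
  have comM : GRing.comm ('X%:M : 'M[{poly A}]_n.+1) (map_mx polyC M).
    exact/esym/comm_mx_scalar.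
  have mapMX : map_mx polyC (M ^+ N) = map_mx polyC M ^+ N.
    by rewrite rmorphXn.
  have := subrXX_comm N comM; rewrite -mapMX MN0 map_mx0 subr0.
  move=> /(congr1 determinant); rewrite -mulmxE det_mulmx -rmorphXn /=.
  by rewrite det_scalar -exprM polyC0 subr0 => ->; rewrite dvdp_mulIl.
have [k _ eqk] := dvdp_exp_XsubCP dvdM.
have /eqP Mk : char_poly M == ('X - 0%:P) ^+ k.
  by rewrite -eqp_monic ?char_poly_monic ?monic_exp ?monicXsubC.
have := char_poly_trace M (ltn0Sn n); rewrite /= Mk polyC0 subr0 coefXn.
have := size_char_poly M; rewrite Mk polyC0 subr0 size_polyXn => -[->].
by rewrite ltn_eqF // => /esym/eqP; rewrite oppr_eq0 => /eqP.
Qed.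

(** * Integrality of the power series ring in z *)

Section FpsDomain.
Variables (R : idomainType) (n : nat).
Implicit Types p q : {fps R[n]}.

Lemma fps_order p : p != 0 ->
  exists2 d, (forall m, (mdeg m < d)%N -> fpscoef p m = 0)
           & exists2 m, mdeg m = d & fpscoef p m != 0.
Proof.
move=> p0; pose P d := `[< exists2 m, mdeg m = d & fpscoef p m != 0 >].
have exP : exists d, P d.
  apply: contrapT => noP; case/eqP: p0; apply/fpsP => m /=.
  by apply: contrapT => /eqP pm; apply: noP; exists (mdeg m); apply/asboolP; exists m.
case: (ex_minnP exP) => d /asboolP Pd dmin; exists d => // m md.
apply/eqP/negPn/negP => pm.
have /dmin : P (mdeg m) by apply/asboolP; exists m.
by rewrite leqNgt md.
Qed.

Lemma fps_truncE_ge d p m : (d <= mdeg m)%N -> (fps_trunc d p)@_m = 0.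
Proof.
move=> dm; rewrite /fps_trunc raddf_sum big1 //= => k _.
rewrite mcoeffZ mcoeffX; case: eqP => [km|]; last by rewrite mulr0.
by have := bmdeg k; rewrite km ltnNge dm.
Qed.

Lemma fps_trunc_spec d p : exists p' : {mpoly R[n]},
  (forall m, (mdeg m <= d)%N -> p'@_m = fpscoef p m) /\
  (forall m, (d < mdeg m)%N -> p'@_m = 0).
Proof.
exists (fps_trunc d.+1 p); split=> m md; first by apply: fps_truncE.
exact: fps_truncE_ge.
Qed.

(** The homogeneous parts of lowest degrees d and e are nonzero polynomials, and their product is
    the part of degree d + e of p q; polynomials over a domain form a domain. *)
Fact fps_mul_eq0 p q : p * q = 0 -> (p == 0) || (q == 0).
Proof.
move=> pq0; apply: contrapT => /negP; rewrite negb_or => /andP[p0 q0].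
have [d plow [m md pm]] := fps_order p0; have [e qlow [l le ql]] := fps_order q0.
have [p' [p'E p'0]] := fps_trunc_spec d p.
have [q' [q'E q'0]] := fps_trunc_spec e q.
(* Coefficients of degree below d vanish, so the truncation [p'] is homogeneous of degree d. *)
have p'ne k : mdeg k != d -> p'@_k = 0.
  rewrite neq_ltn => /orP[kd|]; last exact: p'0.
  by rewrite (p'E _ (ltnW kd)) (plow _ kd).
have q'ne k : mdeg k != e -> q'@_k = 0.
  rewrite neq_ltn => /orP[ke|]; last exact: q'0.
  by rewrite (q'E _ (ltnW ke)) (qlow _ ke).
suff : p' * q' = 0.
  move/eqP; rewrite mulf_eq0 => /orP[] /eqP/mpolyP.
    by move=> /(_ m); rewrite p'E ?md // mcoeff0; apply/eqP.
  by move=> /(_ l); rewrite q'E ?le // mcoeff0; apply/eqP.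
apply/mpolyP => k; rewrite mcoeff0.
have [kde|kde] := eqVneq (mdeg k) (d + e)%N; last first.
  rewrite mcoeffM big1 // => k12 /eqP kE.
  have := congr1 mdeg kE; rewrite mdegD => kdeg.
  have [k1d|/p'ne ->] := eqVneq (mdeg k12.1) d; last by rewrite mul0r.
  rewrite [X in _ * X]q'ne ?mulr0 //; apply: contraNneq kde => k2e.
  by rewrite kdeg k1d k2e.
transitivity (fpscoef (p * q) k); last by rewrite pq0.
rewrite mcoeffM; apply: eq_bigr => k12 /eqP kE.
have kdeg : (d + e)%N = (mdeg k12.1 + mdeg k12.2)%N by rewrite -mdegD -kE kde.
have [k1d|k1d|k1d] := ltngtP (mdeg k12.1) d.
- by rewrite [X in X * _](p'E _ (ltnW k1d)) (plow _ k1d) !mul0r.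
- rewrite [X in X * _](p'0 _ k1d) [X in _ = _ * X]qlow ?mulr0 ?mul0r //.
  by rewrite -(ltn_add2l d) kdeg ltn_add2r.
have k2e : mdeg k12.2 = e by apply/eqP; rewrite -(eqn_add2l d) kdeg k1d.
by rewrite [X in X * _ = _]p'E ?k1d // [X in _ * X = _]q'E ?k2e.
Qed.

(** Invertibility and inverses come from classical choice; [fps_inv] fixes non-units, as the unit
    ring interface requires. *)
Definition fps_unit : pred {fps R[n]} := fun p => `[< exists q, q * p = 1 >].
Definition fps_inv p : {fps R[n]} :=
  if pselect (exists q, q * p = 1) is left e then projT1 (cid e) else p.

Fact fps_mulVp : {in fps_unit, left_inverse 1 fps_inv *%R}.
Proof.
move=> p /asboolP pu; rewrite /fps_inv; case: pselect => // e.
by case: cid.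
Qed.
Fact fps_unitP p q : q * p = 1 -> fps_unit p.
Proof. by move=> qp; apply/asboolP; exists q. Qed.
Fact fps_inv_out : {in [predC fps_unit], fps_inv =1 id}.
Proof. by move=> p /asboolP pu; rewrite /fps_inv; case: pselect. Qed.

HB.instance Definition _ := GRing.ComNzRing_hasMulInverse.Build {fps R[n]}
  fps_mulVp fps_unitP fps_inv_out.
HB.instance Definition _ := GRing.ComUnitRing_isIntegral.Build {fps R[n]}
  fps_mul_eq0.

End FpsDomain.

(** * Partial derivatives of power series *)

Section FpsDerivation.
Variables (R : comNzRingType) (n : nat).
Implicit Types p q : {fps R[n]}.

Lemma fps_deriv_derivation (i : 'I_n) : derivation (@fps_deriv R n i).
Proof.
split=> [p q|p q]; first by apply/fpsP => m; rewrite /= mulrnDl.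
apply/fpsP => m; pose d := (mdeg m).+1.
(* A derivative at m involves coefficients of degree d, one above that of m; [fps_trunc d.+1] keeps
   them. *)
have tE s k : (mdeg k <= d)%N -> (fps_trunc d.+1 s)@_k = fpscoef s k.
  by move=> km; rewrite fps_truncE.
have tD s k : (mdeg k <= mdeg m)%N ->
    ((fps_trunc d.+1 s)^`M(i))@_k = fpscoef (fps_deriv i s) k.
  by move=> km; rewrite mcoeff_deriv tE // mdegD mdeg1 addn1.
have -> : fpscoef (fps_deriv i (p * q)) m =
    ((fps_trunc d.+1 p * fps_trunc d.+1 q)^`M(i))@_m.
  rewrite mcoeff_deriv /=; congr (_ *+ _).
  have mE : mdeg (m + U_(i)) = d by rewrite mdegD mdeg1 addn1.
  by apply: fps_mul_mpoly => k; rewrite mE; apply: tE.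
rewrite mderivM mcoeffD fpscoefD; congr (_ + _); symmetry; apply: fps_mul_mpoly;
  by move=> k km; rewrite ?tD ?tE // leqW.
Qed.

Lemma fps_derivC (i j : 'I_n) p :
  fps_deriv i (fps_deriv j p) = fps_deriv j (fps_deriv i p).
Proof.
apply/fpsP => m /=; rewrite -!mulrnA.
rewrite -!addmA [(U_(i) + _)%MM]addmC; congr (_ *+ _).
by rewrite !mnmDE !mnm1E (eq_sym i j); case: eqVneq => [->|_] //=; rewrite !addn0 mulnC.
Qed.

End FpsDerivation.

(** The inverse is the constant series 1/(k+1). Such inverses make integration in t possible. *)
Lemma fps_natr_unit (R : fieldType) n k : k.+1%:R != 0 :> R ->
  (k.+1%:R : {fps R[n]}) \is a GRing.unit.
Proof.
move=> k0; pose c (a : R) : {fps R[n]} := FPS (fun m => a *+ (m == 0%MM)).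
have cE m : fpscoef (k.+1%:R : {fps R[n]}) m = fpscoef (c k.+1%:R) m.
  elim: k.+1 => [|j IH] /=; first by rewrite mul0rn.
  by rewrite !mulrS fpscoefD IH /= mulrnDl.
apply: (@fps_unitP _ _ _ (c (k.+1%:R^-1))); apply/fpsP => m.
rewrite (@fps_mul_mpoly _ _ _ _ (k.+1%:R^-1)%:MP (k.+1%:R)%:MP).
- by rewrite -mpolyCM mulVf // mcoeffC mul1r.
- by move=> l _; rewrite mcoeffC /= mulr_natr.
- by move=> l _; rewrite mcoeffC cE /= mulr_natr.
Qed.

(* Formal power series in the deformation parameter t; tcoef f m is the
   coefficient of t^m. *)
Record tseries (A : Type) := TSeries { tcoef : nat -> A }.

HB.instance Definition _ (A : Type) := [isNew for @tcoef A].
HB.instance Definition _ (A : eqType) := [Equality of tseries A by <:].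
HB.instance Definition _ (A : choiceType) := [Choice of tseries A by <:].

Lemma tseriesP (A : Type) (f g : tseries A) : tcoef f =1 tcoef g -> f = g.
Proof. by case: f g => [f] [g] /= fg; congr TSeries; apply/funext. Qed.

(** * The ring of power series in t *)

Section TseriesZmodule.
Variable A : zmodType.
Implicit Types f g : tseries A.

Definition tseries_zero : tseries A := TSeries (fun=> 0).
Definition tseries_opp f : tseries A := TSeries (fun m => - tcoef f m).
Definition tseries_add f g : tseries A := TSeries (fun m => tcoef f m + tcoef g m).

Fact tseries_addA : associative tseries_add.
Proof. by move=> f g h; apply/tseriesP => m; apply: addrA. Qed.
Fact tseries_addC : commutative tseries_add.
Proof. by move=> f g; apply/tseriesP => m; apply: addrC. Qed.
Fact tseries_add0 : left_id tseries_zero tseries_add.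
Proof. by move=> f; apply/tseriesP => m; apply: add0r. Qed.
Fact tseries_addN : left_inverse tseries_zero tseries_opp tseries_add.
Proof. by move=> f; apply/tseriesP => m; apply: addNr. Qed.

HB.instance Definition _ := GRing.isZmodule.Build (tseries A)
  tseries_addA tseries_addC tseries_add0 tseries_addN.

Lemma tcoef0 m : tcoef (0 : tseries A) m = 0. Proof. by []. Qed.
Lemma tcoefD f g m : tcoef (f + g) m = tcoef f m + tcoef g m. Proof. by []. Qed.
Lemma tcoefMn f k m : tcoef (f *+ k) m = tcoef f m *+ k.
Proof. by elim: k => // k IHk; rewrite !mulrS tcoefD IHk. Qed.
Lemma tcoef_sum (I : Type) (r : seq I) (S : pred I) (F : I -> tseries A) m :
  tcoef (\sum_(i <- r | S i) F i) m = \sum_(i <- r | S i) tcoef (F i) m.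
Proof. by elim/big_rec2: _ => // i x y _ <-. Qed.

End TseriesZmodule.

Section TseriesRing.
Variable A : comNzRingType.
Implicit Types f g : tseries A.

Definition tpoly (p : {poly A}) : tseries A := TSeries (fun m => p`_m).
Definition tseries_mul f g : tseries A :=
  TSeries (fun m => \sum_(i < m.+1) tcoef f i * tcoef g (m - i)).

Definition ttrunc m f : {poly A} := \poly_(i < m.+1) tcoef f i.

Lemma ttruncE m f i : (i <= m)%N -> (ttrunc m f)`_i = tcoef f i.
Proof. by move=> im; rewrite coef_poly ltnS im. Qed.

(** The coefficient of t^m in a product involves only coefficients up to t^m of the factors, so ring
    axioms carry over from [{poly A}]. *)
Lemma tseries_mul_poly f g (p q : {poly A}) m :
    (forall i, (i <= m)%N -> p`_i = tcoef f i) ->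
    (forall i, (i <= m)%N -> q`_i = tcoef g i) ->
  tcoef (tseries_mul f g) m = (p * q)`_m.
Proof.
move=> pE qE; rewrite coefM; apply: eq_bigr => i _.
by rewrite pE ?qE ?leq_subr // -ltnS.
Qed.

Fact tseries_mulA : associative tseries_mul.
Proof.
move=> f g h; apply/tseriesP => m.
have tE e i : (i <= m)%N -> (ttrunc m e)`_i = tcoef e i by apply: ttruncE.
have tM e e' i : (i <= m)%N ->
    (ttrunc m e * ttrunc m e')`_i = tcoef (tseries_mul e e') i.
  move=> im; symmetry; apply: tseries_mul_poly => j ji; apply: tE;
  exact: leq_trans ji im.
by rewrite (tseries_mul_poly (tE f) (tM g h)) mulrA -(tseries_mul_poly (tM f g) (tE h)).
Qed.

Fact tseries_mulC : commutative tseries_mul.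
Proof.
move=> f g; apply/tseriesP => m.
have tE e i : (i <= m)%N -> (ttrunc m e)`_i = tcoef e i by apply: ttruncE.
by rewrite (tseries_mul_poly (tE f) (tE g)) mulrC -(tseries_mul_poly (tE g) (tE f)).
Qed.

Fact tseries_mul1 : left_id (tpoly 1) tseries_mul.
Proof.
move=> f; apply/tseriesP => m.
have tE i : (i <= m)%N -> (ttrunc m f)`_i = tcoef f i by apply: ttruncE.
by rewrite (tseries_mul_poly (p := 1) _ tE) // mul1r tE.
Qed.

Fact tseries_mulDl : left_distributive tseries_mul +%R.
Proof.
move=> f g h; apply/tseriesP => m; rewrite tcoefD -big_split /=.
by apply: eq_bigr => i _; rewrite mulrDl.
Qed.

Fact tseries_one_neq0 : tpoly 1 != 0.
Proof.
apply/eqP => /(congr1 (fun f => tcoef f 0)) /=; rewrite coef1 => /eqP.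
by rewrite oner_eq0.
Qed.

HB.instance Definition _ := GRing.Zmodule_isComNzRing.Build (tseries A)
  tseries_mulA tseries_mulC tseries_mul1 tseries_mulDl tseries_one_neq0.

Lemma tcoefM f g m :
  tcoef (f * g) m = \sum_(i < m.+1) tcoef f i * tcoef g (m - i).
Proof. by []. Qed.

Definition tconst_coef f := tcoef f 0.

Fact tconst_coef_is_zmod_morphism : zmod_morphism tconst_coef.
Proof. by []. Qed.
Fact tconst_coef_is_monoid_morphism : monoid_morphism tconst_coef.
Proof.
split; first by rewrite /tconst_coef /= coef1.
by move=> f g; rewrite /tconst_coef tcoefM big_ord1.
Qed.
HB.instance Definition _ := GRing.isZmodMorphism.Build (tseries A) A
  tconst_coef tconst_coef_is_zmod_morphism.
HB.instance Definition _ := GRing.isMonoidMorphism.Build (tseries A) A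
  tconst_coef tconst_coef_is_monoid_morphism.

Fact tpoly_is_zmod_morphism : zmod_morphism tpoly.
Proof. by move=> p q; apply/tseriesP => m; rewrite /= coefB. Qed.
Fact tpoly_is_monoid_morphism : monoid_morphism tpoly.
Proof.
by split=> // p q; apply/tseriesP => m; symmetry; apply: tseries_mul_poly.
Qed.
HB.instance Definition _ := GRing.isZmodMorphism.Build {poly A} (tseries A)
  tpoly tpoly_is_zmod_morphism.
HB.instance Definition _ := GRing.isMonoidMorphism.Build {poly A} (tseries A)
  tpoly tpoly_is_monoid_morphism.

Lemma tpoly_inj : injective tpoly.
Proof. by move=> p q pq; apply/polyP => m; apply: (congr1 (fun f => tcoef f m) pq). Qed.

Lemma tcoef_Cmul (c : A) f m : tcoef (tpoly c%:P * f) m = c * tcoef f m.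
Proof.
rewrite tcoefM big_ord_recl /= coefC eqxx subn0 big1 ?addr0 // => i _.
by rewrite coefC mul0r.
Qed.

Definition tderiv f : tseries A := TSeries (fun m => tcoef f m.+1 *+ m.+1).
Definition tmap (d : A -> A) f : tseries A := TSeries (fun m => d (tcoef f m)).

Lemma tderiv_derivation : derivation tderiv.
Proof.
split=> f g; first by apply/tseriesP => m; rewrite /= mulrnDl.
apply/tseriesP => m.
have tE e i : (i <= m.+1)%N -> (ttrunc m.+1 e)`_i = tcoef e i by apply: ttruncE.
have tD e i : (i <= m)%N -> (ttrunc m.+1 e)^`()`_i = tcoef (tderiv e) i.
  by move=> im; rewrite coef_deriv tE.
have -> : tcoef (tderiv (f * g)) m = (ttrunc m.+1 f * ttrunc m.+1 g)^`()`_m.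
  by rewrite coef_deriv -(tseries_mul_poly (tE f) (tE g)).
rewrite derivM coefD tcoefD; congr (_ + _); symmetry; apply: tseries_mul_poly;
  by move=> i im; rewrite ?tD ?tE // leqW.
Qed.

Lemma tmap_derivation d : derivation d -> derivation (tmap d).
Proof.
move=> d_der; split=> f g; apply/tseriesP => m; first exact: (derD d_der).
transitivity (d (tcoef (f * g) m)); first by [].
rewrite tcoefD !tcoefM (der_sum d_der) -big_split; apply: eq_bigr => i _.
exact: (derM d_der).
Qed.

Lemma tderiv_eq0 f : (forall (x : A) k, x *+ k.+1 = 0 -> x = 0) ->
  tderiv f = 0 -> forall m, (0 < m)%N -> tcoef f m = 0.
Proof.
move=> mulrSn_eq0 f'0 [//|m] _; apply: (mulrSn_eq0 _ m).
exact: (congr1 (fun g => tcoef g m) f'0).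
Qed.

(** Being a polynomial in t, phrased like the vanishing for large m in the theorem. *)
Definition tfinite f : Prop := exists M, forall m, (M <= m)%N -> tcoef f m = 0.

Lemma tfinite_tpoly p : tfinite (tpoly p).
Proof. by exists (size p) => m; apply: nth_default. Qed.

Lemma tfiniteP f : tfinite f -> exists p, f = tpoly p.
Proof.
case=> M fM; exists (\poly_(i < M) tcoef f i); apply/tseriesP => m /=.
by rewrite coef_poly; case: ltnP => [//|/fM].
Qed.

Lemma tfiniteD f g : tfinite f -> tfinite g -> tfinite (f + g).
Proof.
move=> /tfiniteP[p ->] /tfiniteP[q ->]; rewrite -rmorphD.
exact: tfinite_tpoly.
Qed.

Lemma tfiniteM f g : tfinite f -> tfinite g -> tfinite (f * g).
Proof.
move=> /tfiniteP[p ->] /tfiniteP[q ->]; rewrite -rmorphM.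
exact: tfinite_tpoly.
Qed.

Lemma tfiniteMn f k : tfinite f -> tfinite (f *+ k).
Proof. by move=> [M fM]; exists M => m /fM fm; rewrite tcoefMn fm mul0rn. Qed.

Lemma tfiniteX f k : tfinite f -> tfinite (f ^+ k).
Proof.
move=> /tfiniteP[p ->]; rewrite -rmorphXn; exact: tfinite_tpoly.
Qed.

Lemma tfinite_sum (I : Type) (r : seq I) (F : I -> tseries A) :
  (forall i, tfinite (F i)) -> tfinite (\sum_(i <- r) F i).
Proof.
move=> fin_F; elim/big_rec: _ => [|i f _]; first by exists 0.
exact: tfiniteD.
Qed.

Lemma tfinite_deriv f : tfinite f -> tfinite (tderiv f).
Proof. by case=> M fM; exists M => m Mm; rewrite /= fM ?mul0rn // leqW. Qed.

Lemma tfinite_map d f : derivation d -> tfinite f -> tfinite (tmap d f).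
Proof.
by move=> d_der [M fM]; exists M => m Mm; rewrite /= fM // (der0 d_der).
Qed.

End TseriesRing.

(** * Zero divisors among power series in t *)

Section TseriesDomain.
Variable A : idomainType.
Implicit Types f g : tseries A.

Lemma tseries_order f : f != 0 ->
  exists2 i, tcoef f i != 0 & forall j, (j < i)%N -> tcoef f j = 0.
Proof.
move=> f0; have exi : exists i, tcoef f i != 0.
  apply: contrapT => noi; case/eqP: f0; apply/tseriesP => m /=.
  by apply: contrapT => /eqP fm; apply: noi; exists m.
case: (ex_minnP exi) => i fi imin; exists i => // j ji.
by apply/eqP/negPn/negP => /imin; rewrite leqNgt ji.
Qed.

(** The lowest nonzero coefficients of f and g multiply to a nonzero coefficient of f g. *)
Lemma tseries_mul_eq0 f g : f * g = 0 -> f = 0 \/ g = 0.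
Proof.
move=> fg0; have [->|f0] := eqVneq f 0; [by left | right].
apply/eqP; apply: contraT => g0.
have [i fi flow] := tseries_order f0; have [j gj glow] := tseries_order g0.
have : tcoef (f * g) (i + j) = 0 by rewrite fg0.
have iij : (i < (i + j).+1)%N by rewrite ltnS leq_addr.
rewrite tcoefM (bigD1 (Ordinal iij)) //= addKn big1 ?addr0 => [/eqP|k ki].
  by rewrite mulf_eq0 (negPf fi) (negPf gj).
have [lt_ki|lt_ik|eq_ki] := ltngtP k i.
- by rewrite flow ?mul0r.
- by rewrite [X in _ * X]glow ?mulr0 // ltn_subLR ?ltn_add2r // -ltnS.
by case/eqP: ki; apply: val_inj.
Qed.

Lemma tseries_exp_eq0 f k : f ^+ k = 0 -> f = 0.
Proof.
elim: k => [|k IHk]; first by rewrite expr0 => /eqP; rewrite oner_eq0.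
by rewrite exprS => /tseries_mul_eq0[|/IHk].
Qed.

End TseriesDomain.

(** * The Hamilton-Jacobi equation over a domain with commuting derivations *)

Section HessianNilpotent.
Variables (A : idomainType) (n : nat) (d : 'I_n -> A -> A) (P : A).
Hypothesis d_der : forall l, derivation (d l).
Hypothesis dC : forall i j x, d i (d j x) = d j (d i x).
Hypothesis natr_unit : forall m, (m.+1%:R : A) \is a GRing.unit.

Local Notation B := (tseries A).
Local Notation D l := (tmap (d l)).

Definition laplacian (x : A) : A := \sum_l d l (d l x).
Definition hessian (x : A) : 'M[A]_n := \matrix_(i, j) d i (d j x).
Definition tlaplacian (f : B) : B := \sum_l D l (D l f).
Definition tgrad2 (f : B) : B := \sum_l D l f ^+ 2.

(** The list Q_0, ..., Q_m, kept whole because each Q_m depends on all earlier ones: the coefficient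
    of t^(m-1) in the equation gives m Q_m as a sum of products of derivatives of Q_i and
    Q_(m-1-i). *)
Fixpoint hamilton_jacobi_seq (m : nat) : seq A :=
  if m is m'.+1 then
    let s := hamilton_jacobi_seq m' in
    rcons s (m%:R^-1 *
      \sum_l \sum_(i < m) d l s`_i * d l s`_(m' - i))
  else [:: P].

Lemma mulrSn_eq0 (x : A) m : x *+ m.+1 = 0 -> x = 0.
Proof. by rewrite -mulr_natr => /(canRL (mulrK (natr_unit m))); rewrite mul0r. Qed.

Lemma hamilton_jacobi_exists :
  exists2 Q : B, tcoef Q 0 = P & tderiv Q = tgrad2 Q.
Proof.
pose s := hamilton_jacobi_seq.
have size_s m : size (s m) = m.+1 by elim: m => //= m IHm; rewrite size_rcons IHm.
have sE m i : (i <= m)%N -> (s m)`_i = (s i)`_i.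
  elim: m => [|m IHm]; first by case: i.
  rewrite leq_eqVlt => /predU1P[->//|]; rewrite ltnS => im.
  by rewrite /= nth_rcons size_s ltnS im IHm.
exists (TSeries (fun m => (s m)`_m)) => //; apply/tseriesP => m.
rewrite /= nth_rcons size_s ltnn eqxx -[LHS]mulr_natl mulrA mulrV ?natr_unit // mul1r.
rewrite tcoef_sum; apply: eq_bigr => l _; rewrite expr2 tcoefM.
by apply: eq_bigr => i _ /=; rewrite !sE // ?leq_subr // -ltnS.
Qed.

Lemma DC i j f : D i (D j f) = D j (D i f).
Proof. by apply/tseriesP => m; apply: dC. Qed.

Lemma tderivD l f : tderiv (D l f) = D l (tderiv f).
Proof. by apply/tseriesP => m; rewrite /= (derMn (d_der l)). Qed.

Let D_der l : derivation (D l). Proof. exact: tmap_derivation. Qed.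
Let tderiv_der : derivation (@tderiv A). Proof. exact: tderiv_derivation. Qed.

(** * Vanishing traces along the deformation *)

Variable Q : B.
Hypothesis Q0 : tcoef Q 0 = P.
Hypothesis Q_hj : tderiv Q = tgrad2 Q.
Variable N : nat.
Hypothesis P_nilpotent : hessian P ^+ N = 0.

Definition thessian : 'M[B]_n := \matrix_(i, j) D i (D j Q).

(* The derivation for which differentiating the Hamilton-Jacobi equation of Q
   twice gives the matrix Riccati equation of flow_deriv_thessian. *)
Definition flow_deriv (f : B) : B := tderiv f - \sum_l (D l Q *+ 2) * D l f.

Lemma flow_deriv_derivation : derivation flow_deriv.
Proof. exact: derivation_sub_lincomb. Qed.

(** Applying D_i D_j to the sum of the (D_l Q)^2 gives twice the sum of (D_i D_l Q)(D_j D_l Q) + D_l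
    Q D_l D_i D_j Q. The flow derivation subtracts the second terms; the first ones form 2 H^2. *)
Lemma flow_deriv_thessian :
  map_mx flow_deriv thessian = (thessian *m thessian) *+ 2.
Proof.
apply/matrixP => i j; rewrite mulmxnE !mxE /flow_deriv !tderivD Q_hj /tgrad2.
rewrite (der_sum (D_der j)) (der_sum (D_der i)) -sumrB -sumrMnl.
apply: eq_bigr => l _; rewrite !mxE (derX (D_der j)) expr1 (derMn (D_der i)).
rewrite (derM (D_der i)) mulrnDl (DC j l) mulrnAl [D i (D l _)]DC.
by rewrite [D i (D l (D j Q))]DC addrK (DC l i).
Qed.

Lemma map_mx_exp (S T : nzRingType) (f : {rmorphism S -> T}) (M : 'M_n) k :
  map_mx f (M ^+ k) = map_mx f M ^+ k.
Proof.
elim: k => [|k IHk]; first by rewrite !expr0 map_mx1.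
by rewrite !exprS -!mulmxE map_mxM IHk.
Qed.

(** Induction on the power of t, for all k at once: the Riccati equation expresses the coefficient
    of t^(m+1) in tr H^(k+1) by that of t^m in tr H^(k+2) and by those up to t^m in tr H^(k+1). *)
Lemma trace_thessian_exp k : \tr (thessian ^+ k.+1) = 0.
Proof.
apply/tseriesP => m; elim/ltn_ind: m k => -[|m] IHm k.
  rewrite tcoef0 -[LHS]/(tconst_coef _) /mxtrace raddf_sum.
  transitivity (\tr (hessian P ^+ k.+1)).
    have -> : hessian P = map_mx (@tconst_coef A) thessian.
      by apply/matrixP => i j; rewrite !mxE /tconst_coef /= Q0.
    by rewrite -map_mx_exp; apply: eq_bigr => i _; rewrite mxE.
  (* Powers of the nilpotent Hessian of P are nilpotent with the same N. *)
  by apply: (@trace_nilpotent _ _ _ N); rewrite exprAC P_nilpotent expr0n.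
apply: (@mulrSn_eq0 _ m); rewrite -[LHS]/(tcoef (tderiv _) m).
have -> : tderiv (\tr (thessian ^+ k.+1)) =
    \tr (thessian ^+ k.+2) *+ (2 * k.+1) +
    \sum_l (D l Q *+ 2) * D l (\tr (thessian ^+ k.+1)).
  apply/eqP; rewrite -subr_eq -/(flow_deriv _); apply/eqP.
  rewrite (der_trace flow_deriv_derivation).
  rewrite (der_mxX flow_deriv_derivation _ flow_deriv_thessian).
  by rewrite raddfMn.
rewrite tcoefD tcoefMn IHm // mul0rn add0r tcoef_sum big1 // => l _.
rewrite tcoefM big1 // => i _.
rewrite [X in _ * X](_ : _ = 0) ?mulr0 //= IHm ?(der0 (d_der l)) //.
by rewrite ltnS leq_subr.
Qed.

Lemma tlaplacian_eq0 : tlaplacian Q = 0.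
Proof.
rewrite -(trace_thessian_exp 0) expr1.
by apply: eq_bigr => l _; rewrite mxE.
Qed.

(** * Iterated Laplacians as coefficients of powers of Q *)

(** The Laplacian of Q^(k+1) is k+1 times the sum of <grad Q^k, grad Q> and Q^k times the Laplacian
    of Q. The latter is 0, and the former is k Q^(k-1) |grad Q|^2, the t-derivative of Q^k. *)
Lemma tderivX k : tderiv (Q ^+ k) *+ k.+1 = tlaplacian (Q ^+ k.+1).
Proof.
have -> : tlaplacian (Q ^+ k.+1) =
    (\sum_l D l (Q ^+ k) * D l Q + Q ^+ k * tlaplacian Q) *+ k.+1.
  rewrite /tlaplacian mulr_sumr -big_split -sumrMnl; apply: eq_bigr => l _.
  by rewrite (derX (D_der l)) /= (derMn (D_der l)) (derM (D_der l)).
rewrite tlaplacian_eq0 mulr0 addr0 (derX tderiv_der) Q_hj mulr_sumr -sumrMnl.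
congr (_ *+ _); apply: eq_bigr => l _.
by rewrite (derX (D_der l)) mulrnAl -mulrA expr2.
Qed.

Lemma iter_laplacian_exp m k : exists2 c, (0 < c)%N &
  iter m laplacian (P ^+ (m + k)) = tcoef (Q ^+ k) m *+ c.
Proof.
elim: m k => [|m IHm] k.
  by exists 1%N => //; rewrite -Q0 -[RHS]/(tconst_coef _) rmorphXn.
(* One Laplacian turns Q^(k+1) into k+1 times the t-derivative of Q^k, which contributes the factor
   m+1. In closed form the constant is m! (m+k)! / k!. *)
have [c c0 IHc] := IHm k.+1; exists (m.+1 * (k.+1 * c))%N; first by rewrite !muln_gt0 c0.
rewrite iterS addSnnS IHc !mulrnA -[tcoef _ _ *+ m.+1]/(tcoef (tderiv _) m).
rewrite -[tcoef (tderiv _) m *+ _]tcoefMn tderivX tcoef_sum -sumrMnl; apply: eq_bigr => l _.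
by rewrite !(derMn (d_der l)).
Qed.

Lemma iter_laplacian_exp_eq0 m k :
  iter m laplacian (P ^+ (m + k)) = 0 <-> tcoef (Q ^+ k) m = 0.
Proof.
have [[|c] // _ ->] := iter_laplacian_exp m k.
by split=> [/mulrSn_eq0|->] //; rewrite mul0rn.
Qed.

(** * From a polynomial power of Q to a polynomial Q *)

(** With F = Q^(k+1), both sides equal (k+1)^2 Q^(2k+1) |grad Q|^2. *)
Lemma tgrad2X k :
  tgrad2 (Q ^+ k.+1) * Q = (Q ^+ k.+1 * tderiv (Q ^+ k.+1)) *+ k.+1.
Proof.
rewrite (derX tderiv_der) Q_hj /tgrad2 mulr_suml mulrnAr mulr_sumr mulr_sumr -!sumrMnl.
apply: eq_bigr => l _; rewrite (derX (D_der l)) /=.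
rewrite exprMn_n -mulnn mulrnA !mulrnAl; congr (_ *+ _ *+ _).
by rewrite exprMn (exprSr (Q ^+ k)) expr1 [LHS]mulrC -!mulrA [LHS]mulrA -exprS.
Qed.

Lemma tfinite_root k : tfinite (Q ^+ k.+1) -> tfinite Q.
Proof.
set F := Q ^+ k.+1 => finF.
have finf : tfinite (tgrad2 F).
  by apply: tfinite_sum => l; apply/tfiniteX/tfinite_map.
have fing : tfinite ((F * tderiv F) *+ k.+1).
  by apply/tfiniteMn/tfiniteM => //; apply: tfinite_deriv.
have fQ := tgrad2X k; rewrite -/F in fQ.
(* If |grad F|^2 = 0 then F dF/dt = 0, so Q is 0 or constant in t. *)
have [f0|f0] := eqVneq (tgrad2 F) 0.
  have tMn_eq0 (h : B) j : h *+ j.+1 = 0 -> h = 0.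
    move=> hj; apply/tseriesP => m; apply: (@mulrSn_eq0 _ j).
    by rewrite -tcoefMn hj.
  have : Q = 0 \/ tderiv Q = 0.
    move: fQ; rewrite f0 mul0r => /esym/tMn_eq0/tseries_mul_eq0[/tseries_exp_eq0|]; first by left.
    rewrite (derX tderiv_der) => /tMn_eq0/tseries_mul_eq0[/tseries_exp_eq0|]; [by left | by right].
  case=> [->|Q'0]; first by exists 0.
  by exists 1%N; apply: tderiv_eq0 Q'0; apply: mulrSn_eq0.
have [f fE] := tfiniteP finf; have [g gE] := tfiniteP fing.
have [F' F'E] := tfiniteP finF.
(* The power k+1 of f Q = g, read in [{poly A}]. *)
have : f ^+ k.+1 * F' = g ^+ k.+1.
  by apply: tpoly_inj; rewrite rmorphM !rmorphXn /= -fE -gE -F'E -fQ exprMn.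
move=> /esym fgF; have : f ^+ k.+1 %| g ^+ k.+1 by rewrite fgF dvdp_mulIl.
(* Divisibility in [{poly A}] is meant up to a nonzero scalar, as over the fraction field: f divides
   g gives c g = h f with c nonzero in A. *)
rewrite dvdp_pexp2r // => /Pdiv.Idomain.dvdpP[[c h] /= c0 cg].
have cQ : tpoly c%:P * Q = tpoly h.
  apply/eqP; rewrite -subr_eq0; apply/eqP.
  suff /tseries_mul_eq0[/eqP|//] : tgrad2 F * (tpoly c%:P * Q - tpoly h) = 0.
    by rewrite (negPf f0).
  by rewrite mulrBr mulrCA fQ gE fE -!rmorphM /= mul_polyC cg mulrC subrr.
(* Beyond the degree of h, c times the coefficient of Q is 0, and c cancels. *)
exists (size h) => m hm; have := congr1 (fun f => tcoef f m) cQ.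
rewrite tcoef_Cmul /= nth_default // => /eqP.
by rewrite mulf_eq0 (negPf c0) => /eqP.
Qed.

End HessianNilpotent.

(** * The equivalence, restated as polynomiality in t of powers of Q *)

Theorem theorem6p2 (R : realType) (n : nat) (P : {fps R[i][n]})
    (hP : hessian_nilpotent P) :
  [<-> (forall k : nat, (1 <= k)%N ->
          exists M : nat, forall m : nat, (M <= m)%N ->
            iter m (@fps_laplacian R[i] n) (P ^+ (m + k)) = 0);
       (exists2 k0 : nat, (1 <= k0)%N &
          exists M : nat, forall m : nat, (M <= m)%N ->
            iter m (@fps_laplacian R[i] n) (P ^+ (m + k0)) = 0);
       (exists M : nat, forall m : nat, (M <= m)%N ->
            iter m (@fps_laplacian R[i] n) (P ^+ (m + 1)) = 0)].
Proof.
case: hP => N PN.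
have d_der := @fps_deriv_derivation R[i] n.
have dC := @fps_derivC R[i] n.
have natr_unit m : (m.+1%:R : {fps R[i][n]}) \is a GRing.unit.
  by apply: fps_natr_unit; rewrite Num.Theory.pnatr_eq0.
have [Q Q0 Q_hj] := hamilton_jacobi_exists (@fps_deriv R[i] n) P natr_unit.
have lapE m k : iter m (@fps_laplacian R[i] n) (P ^+ (m + k)) = 0 <->
    tcoef (Q ^+ k) m = 0.
  exact: (iter_laplacian_exp_eq0 d_der dC natr_unit Q0 Q_hj PN).
have finE k : (exists M : nat, forall m : nat, (M <= m)%N ->
      iter m (@fps_laplacian R[i] n) (P ^+ (m + k)) = 0) <-> tfinite (Q ^+ k).
  by split=> -[M QM]; exists M => m /QM /lapE.
(* The cycle (1), (2), (3), (1): take k0 = 1; extract a root of Q^k0; take powers of the polynomial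
   Q. *)
tfae=> [all_k|[[//|k0] _ /finE Qk0]|/finE Q1 k _].
- by exists 1%N; [|apply: all_k].
- by apply/finE; rewrite expr1; apply: tfinite_root Qk0.
- by apply/finE/tfiniteX; rewrite -[Q]expr1.
Qed.
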